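(* Let $K$ be a field, $R=K[x_1,\dots,x_n]$, let $\mathcal{H}$ be a simple hypergraph with vertex set $\{x_1,\dots,x_n\}$, let $I\subseteq R$ be the edge ideal of $\mathcal{H}$, and let $t\geq 1$ be an integer. (1) Suppose that $\mathcal{H}$ has a self semi-induced matching $\mathcal{S}=\{S_1,\dots,S_i\}$ of type $(i,j)$. Then for each $\ell$ with $1\leq \ell\leq i$ we have $\beta_{i,|S_\ell|(t-1)+j}(R/I^t)\neq 0$, and so $$\mathrm{reg}(R/I^t)\geq |S_\ell|(t-1)+\Big(\Big|\bigcup_{1\leq k\leq i}S_k\Big|-i\Big).$$ (2) Let $s$ be the number of all self semi-induced matchings in $\mathcal{H}$ of type $(i,j)$. Then $$\beta_{i,j}(R/I)\geq s,$$ and if moreover $\mathcal{H}$ is $d$-uniform (with $d\geq 2$), then for all integers $t>1$ $$\beta_{i,d(t-1)+j}(R/I^t)\geq si.$$ (3) Suppose that $\mathcal{H}$ is $d$-uniform (with $d\geq 2$). Then for all integers $t\geq 1$ $$d(t-1)+(d-1)(i.m)_{\mathcal{H}}\leq d(t-1)+(s.s.i.m)'_{\mathcal{H}}\leq \mathrm{reg}(R/I^t).$$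
   Context: A simple hypergraph $\mathcal{H}$ on the finite vertex set $\{x_1,\dots,x_n\}$ is given by a nonempty finite family $\mathcal{E}(\mathcal{H})$ of nonempty subsets (edges), none of which is contained in another. $\mathcal{H}$ is $d$-uniform if all its edges have cardinality $d$. Vertices are identified with the variables of $R$, and an edge $S$ is identified with the square-free monomial $\prod_{x\in S}x$; the edge ideal of $\mathcal{H}$ is the ideal of $R$ generated by the monomials of all edges. $\beta_{i,j}(R/I^t)=\dim_K \mathrm{Tor}_i^R(R/I^t,K)_j$ are the graded Betti numbers, and $\mathrm{reg}(R/I^t)=\max\{j-i : \beta_{i,j}(R/I^t)\neq 0\}$. Let $\mathcal{S}=\{S_1,\dots,S_i\}$ be a family of $i\ge 1$ distinct edges of $\mathcal{H}$. The type of $\mathcal{S}$ is $(i,j)$, where $i$ is its cardinality and $j=|\bigcup_{1\leq\ell\leq i}S_\ell|$. - $\mathcal{S}$ is a matching if its members are pairwise disjoint. - $\mathcal{S}$ is a self matching if $S_k\nsubseteq\bigcup_{1\leq\ell\leq i,\,\ell\neq k}S_\ell$ for all $1\leq k\leq i$. - $\mathcal{S}$ is a semi-induced matching if $S\nsubseteq\bigcup_{1\leq\ell\leq i}S_\ell$ for each $S\in\mathcal{E}(\mathcal{H})\setminus\{S_1,\dots,S_i\}$. - $\mathcal{S}$ is a self semi-induced matching if it is both a self matching and a semi-induced matching. - $\mathcal{S}$ is an induced matching if it is both a matching and a semi-induced matching. $(i.m)_{\mathcal{H}}$ is the maximum size of an induced matching in $\mathcal{H}$, and $(s.s.i.m)'_{\mathcal{H}}=\max\{j-i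 : \text{there is a self semi-induced matching of type }(i,j)\text{ in }\mathcal{H}\}$. *)

(* Defs.v *)
From HB Require Import structures.
From mathcomp Require Import all_boot all_order all_algebra.
From mathcomp Require Export mpoly.

Set Implicit Arguments.
Unset Strict Implicit.
Unset Printing Implicit Defensive.

Import Order.TTheory GRing.Theory Num.Theory.
Local Open Scope ring_scope.

(* Ideals are Prop-valued sets of ring elements: membership in an ideal is not
   decidable in general. *)
Section Ideals.
Variable R : comNzRingType.
Implicit Types (G A B : R -> Prop) (p : R).

Definition ideal_gen G p : Prop :=
  exists2 s : seq (R * R),
    (forall u, u \in s -> G u.2) & p = \sum_(u <- s) u.1 * u.2.

Definition ideal_mul A B : R -> Prop :=
  ideal_gen (fun p => exists a b, [/\ A a, B b & p = a * b]).

Fixpoint ideal_exp A (t : nat) : R -> Prop :=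
  if t is t'.+1 then ideal_mul A (ideal_exp A t') else fun=> True.

End Ideals.

(* The vertex x_(k+1) is the ordinal k : 'I_n. *)
Section Hypergraphs.
Variable n : nat.
Implicit Types E S : {set {set 'I_n}}.

Definition simple_hypergraph E : bool :=
  [&& E != set0, set0 \notin E &
      [forall A in E, forall B in E, (A \subset B) ==> (A == B)]].

Definition uniform (d : nat) E : bool := [forall A in E, #|A| == d].

Definition edge_family E S : bool := (S != set0) && (S \subset E).

Definition matching E S : bool := edge_family E S && trivIset S.

Definition self_matching E S : bool :=
  edge_family E S && [forall A in S, ~~ (A \subset cover (S :\ A))].

Definition semi_induced_matching E S : bool :=
  edge_family E S && [forall A in E :\: S, ~~ (A \subset cover S)].

Definition self_semi_induced_matching E S : bool :=
  self_matching E S && semi_induced_matching E S.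

Definition induced_matching E S : bool :=
  matching E S && semi_induced_matching E S.

Definition matching_type S : nat * nat := (#|S|, #|cover S|).

Definition num_ssim E (i j : nat) : nat :=
  #|[set S | self_semi_induced_matching E S & matching_type S == (i, j)]|.

(* When E is simple, each maximum below is over a nonempty set: a single edge
   is an induced matching and a self semi-induced matching. *)
Definition im_number E : nat := \max_(S | induced_matching E S) #|S|.

(* The subtraction is not truncated: in a self matching each edge has a vertex
   that lies in no other edge of the family, so #|S| <= #|cover S|. *)
Definition ssim_number' E : nat :=
  \max_(S | self_semi_induced_matching E S) (#|cover S| - #|S|).

End Hypergraphs.

Section EdgeIdeal.
Variables (K : fieldType) (n : nat).

Definition edge_monomial (S : {set 'I_n}) : {mpoly K[n]} := \prod_(x in S) 'X_x.

Definition edge_ideal (E : {set {set 'I_n}}) : {mpoly K[n]} -> Prop :=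
  ideal_gen (fun p => exists2 S, S \in E & p = edge_monomial S).

End EdgeIdeal.

Section GradedBetti.
Variables (K : fieldType) (n : nat).
Local Notation R := {mpoly K[n]}.

(* A graded free resolution of R/J by finitely generated free modules,
     ... -> F_2 -> F_1 -> F_0 -> R/J -> 0,
   with F_i = \bigoplus_k R(- gfr_deg i k). Elements of F_i are row vectors and
   the differential F_(i+1) -> F_i is v |-> v *m gfr_diff i. The map F_0 -> R/J
   is v |-> v *m gfr_aug modulo J. The maps are homogeneous of degree 0. *)
Record graded_free_resolution (J : R -> Prop) := GradedFreeResolution {
  gfr_rank : nat -> nat;
  gfr_deg : forall i, 'I_(gfr_rank i) -> nat;
  gfr_diff : forall i, 'M[R]_(gfr_rank i.+1, gfr_rank i);
  gfr_aug : 'cV[R]_(gfr_rank 0);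
  gfr_diff_homog : forall i k l m, m \in msupp (gfr_diff i k l) ->
    (mdeg m + gfr_deg l)%N = gfr_deg k;
  gfr_aug_homog : forall k m, m \in msupp (gfr_aug k 0) -> mdeg m = gfr_deg k;
  gfr_aug_surj : forall p : R,
    exists v : 'rV[R]_(gfr_rank 0), J (p - (v *m gfr_aug) 0 0);
  gfr_exact0 : forall v : 'rV[R]_(gfr_rank 0),
    J ((v *m gfr_aug) 0 0) <-> exists w, v = w *m gfr_diff 0;
  gfr_exactS : forall i (v : 'rV[R]_(gfr_rank i.+1)),
    v *m gfr_diff i = 0 <-> exists w, v = w *m gfr_diff i.+1
}.

Variable J : R -> Prop.
Implicit Type F : graded_free_resolution J.

(* Here K = R/(x_1,...,x_n), so the functor - (x)_R K takes constant terms: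
   F_i (x) K = K^(gfr_rank i), and this is the matrix of the differential
   F_(i+1) (x) K -> F_i (x) K. *)
Definition tensor_diff F i : 'M[K]_(gfr_rank F i.+1, gfr_rank F i) :=
  map_mx (mcoeff 0%MM) (gfr_diff F i).

(* Subspaces of F_i (x) K are row spaces; this one is the component of degree j,
   spanned by the basis vectors of degree j. *)
Definition tensor_comp F i (j : nat) : 'M[K]_(gfr_rank F i) :=
  diag_mx (\row_k (gfr_deg (g := F) k == j)%:R).

Definition tor_cycles F i (j : nat) : 'M[K]_(gfr_rank F i) :=
  match i return 'M[K]_(gfr_rank F i) with
  | 0%N => tensor_comp F 0 j
  | i'.+1 => (tensor_comp F i'.+1 j :&: kermx (tensor_diff F i'))%MS
  end.

Definition tor_boundaries F i (j : nat) : 'M[K]_(gfr_rank F i.+1, gfr_rank F i) :=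
  tensor_comp F i.+1 j *m tensor_diff F i.

(* \dim_K Tor_i^R(R/J, K)_j = \dim_K H_i(F (x)_R K)_j, which does not depend on
   the resolution F of R/J. *)
Definition betti F (i j : nat) : nat :=
  (\rank (tor_cycles F i j) - \rank (tor_boundaries F i j))%N.

(* r = \max {j - i : \beta_(i,j)(R/J) <> 0} *)
Definition is_reg F (r : int) : Prop :=
  (exists i j, betti F i j != 0 /\ r = j%:Z - i%:Z) /\
  (forall i j, betti F i j != 0 -> j%:Z - i%:Z <= r).

End GradedBetti.

(* Main.v *)
Require Import Defs.
From HB Require Import structures.
From mathcomp Require Import all_boot all_order all_algebra.
From mathcomp Require Import mpoly.

Set Implicit Arguments.
Unset Strict Implicit.
Unset Printing Implicit Defensive.

Import Order.TTheory GRing.Theory Num.Theory.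
Local Open Scope ring_scope.

(** Each pair of a self semi-induced matching S = {S_0, ..., S_(i-1)} and an
    edge A of S gives a nonzero class of multidegree
    a = (t-1) 1_A + 1_U, U the union of S, in Tor_i(R/I^t, K), and classes of
    distinct multidegrees are independent. When t > 1 the exponents of a that
    exceed 1 recover A, its support recovers U, and S is the set of edges
    inside U because S is semi-induced; hence s * i classes in (2). When t = 1
    the degree only remembers S, hence s classes. In (3), an induced matching of
    a d-uniform hypergraph is self semi-induced, of type (i, d i)
    ([im_le_ssim]), and the bound on the regularity is (1) for a matching that
    attains the maximum.

    The resolution F is arbitrary, possibly neither minimal nor multigraded, so
    the classes are found inside F itself, by a cycle and a functional that
    pair to a nonzero value.

    The cycle. Choose a private vertex p_k of each S_k and let m = x^(a-p),
    p the sum of the p_k. Then x_(p_k) m is in I^t for each k: it is divisible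
    by x_A^(t-1) x_(S_k), since p_l is not in S_k for l <> k. So 1 |-> m
    is a map from R/(x_(p_0), ..., x_(p_(i-1))) to R/I^t, which lifts to a
    homogeneous chain map from the Koszul complex of these variables to F
    ([koszul_map]). Modulo the variables, the image of the top generator is a
    cycle of F_i (x) K of degree |a|.

    The functional. Send each vertex of U to an edge of S that contains it, to
    A whenever possible. This cuts U into i blocks, and a monomial of I^t that
    divides x^a agrees with x^a on some block: a product of t edges is either
    x_A^t, or has a factor B <> A, and then B is in S because it lies in U.
    Call a block full at b <= a when b agrees with a on it. Let C_l be the
    multigraded R-module that is K in the degrees b <= a whose full blocks are
    the first l or the first l+1 ones, and 0 elsewhere. The evident maps
    C_i -> ... -> C_0 form an exact sequence, with C_i = K concentrated in
    degree a, that ends in the quotient of R/I^t spanned by the monomials that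
    divide x^a and have no full block. Hence F maps to it, and F_i -> C_i = K
    is a functional that kills boundaries. Here the map F -> C is an explicit
    truncation of the differentials ([stratum_map]).

    The pairing. The composite of the two chain maps has a scalar in each
    degree, and these scalars satisfy a recursion with Koszul signs
    ([pairing_step]). If both sides come from the same S and A, a single chain
    of terms survives and the pairing is 1 up to sign ([pairing_eq]). If the
    degrees differ, the composite is null-homotopic in the relevant degree and
    the pairing vanishes ([pairing_neq]). So the matrix of pairings is diagonal
    and invertible, which bounds the Betti number from below ([betti_ge]). *)

(** * Truncating polynomials to a set of monomials *)

Section Truncation.
Variables (K : fieldType) (n : nat).
Implicit Types (P : pred 'X_{1..n}) (p q : {mpoly K[n]}) (m b : 'X_{1..n}).

Definition mtrunc P p : {mpoly K[n]} :=
  \sum_(m <- msupp p | P m) p@_m *: 'X_[m].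

Lemma mcoeff_trunc P p m : (mtrunc P p)@_m = if P m then p@_m else 0.
Proof.
rewrite /mtrunc raddf_sum /=.
under eq_bigr => m' _ do rewrite mcoeffZ mcoeffX.
have [m_p|] := boolP (m \in msupp p); last first.
  move=> m_p; rewrite (memN_msupp_eq0 m_p) if_same.
  rewrite big_seq_cond big1 // => m' /andP[m'_p _].
  by case: eqP m_p => [<-|]; rewrite ?m'_p // mulr0.
case: ifP => Pm.
  rewrite big_mkcond (bigD1_seq m) ?msupp_uniq //= Pm eqxx mulr1 big1 ?addr0 //.
  by move=> m' /negPf ->; rewrite mulr0 if_same.
by rewrite big1 // => m' Pm'; case: eqP Pm' => [->|]; rewrite ?Pm // mulr0.
Qed.

Lemma mem_trunc P p m : (m \in msupp (mtrunc P p)) = P m && (m \in msupp p).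
Proof. by rewrite !mcoeff_msupp mcoeff_trunc; case: (P m) => //; rewrite eqxx. Qed.

Lemma eq_mcoeffMr p q q' b :
  (forall b', (b' <= b)%MM -> q@_b' = q'@_b') -> (p * q)@_b = (p * q')@_b.
Proof.
move=> eq_q; rewrite !mcoeffM; apply: eq_bigr => k /eqP b_k.
by rewrite (eq_q k.2) //; apply: lepm_trans (lem_addl k.1 _) _; rewrite -b_k lepm_refl.
Qed.

Lemma mcoeffM_supp p q b : (p * q)@_b != 0 ->
  exists m1 m2, [/\ m1 \in msupp p, m2 \in msupp q & b = (m1 + m2)%MM].
Proof.
rewrite -mcoeff_msupp => /msuppM_le /allpairsP[[m1 m2] /= [? ? ->]].
by exists m1, m2.
Qed.

Lemma mcoeffXM i p m :
  ('X_i * p)@_m = if (0 < m i)%N then p@_(m - U_(i)) else 0.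
Proof.
case: ifP => mi; last first.
  apply/eqP/negP => /negP /mcoeffM_supp[m1 [m2 []]].
  rewrite msuppX inE => /eqP -> _ m_eq.
  by move: mi; rewrite m_eq mnmDE mnm1E eqxx.
have Um : (U_(i) <= m)%MM by rewrite lep1mP -lt0n.
by rewrite -commr_mpolyX -{1}(submK Um) addmC mcoeffMX.
Qed.

Lemma mcoeff_mulmx r (w : 'rV[{mpoly K[n]}]_r) (u : 'cV[{mpoly K[n]}]_r) b :
  ((w *m u) 0 0)@_b = \sum_k (w 0 k * u k 0)@_b.
Proof. by rewrite mxE raddf_sum. Qed.

Lemma eq_mcoeff_mulmx r (w : 'rV[{mpoly K[n]}]_r) (u u' : 'cV_r) b :
  (forall k b', (b' <= b)%MM -> (u k 0)@_b' = (u' k 0)@_b') ->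
  ((w *m u) 0 0)@_b = ((w *m u') 0 0)@_b.
Proof.
by move=> eq_u; rewrite !mcoeff_mulmx; apply: eq_bigr => k _; apply/eq_mcoeffMr/eq_u.
Qed.

End Truncation.

(** The exponent of the square-free monomial of a vertex set. *)
Definition mnm_ind n (T : {set 'I_n}) : 'X_{1..n} := [multinom (v \in T : nat) | v < n].

Lemma mnm_indE n (T : {set 'I_n}) v : mnm_ind T v = (v \in T) :> nat.
Proof. exact: mnmE. Qed.

(** * Degrees below a, sorted by their full blocks *)
Section Strata.
Variables (n i : nat) (a : 'X_{1..n}) (blk : 'I_n -> nat).
Implicit Type b : 'X_{1..n}.

Definition full b (k : nat) := [forall v, (blk v == k) ==> (a v <= b v)%N].

(** The blocks are the fibres of [blk] over 0, ..., i-1. In stratum l the full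
    blocks are exactly the first l: fixing the order in which blocks fill up
    makes each term of the target complex at most one-dimensional in each
    degree, and its differentials free of signs. *)
Definition stratum l b :=
  (b <= a)%MM && [forall k : 'I_i, full b k == (k < l)%N].

Lemma fullP b k : reflect (forall v, blk v = k -> a v <= b v)%N (full b k).
Proof.
apply: (iffP forallP) => [h v bk|h v]; first by apply: (implyP (h v)); rewrite bk.
by apply/implyP => /eqP; apply: h.
Qed.

Lemma full_mono b b' k : (b <= b')%MM -> full b k -> full b' k.
Proof.
move=> /mnm_lepP le_b /fullP fb; apply/fullP => v /fb/leq_trans; exact.
Qed.

Lemma stratumP l b :
  reflect ((b <= a)%MM /\ forall k, (k < i)%N -> full b k = (k < l)%N) (stratum l b).
Proof.
apply: (iffP andP) => [[ba /forallP h]|[ba h]]; split => //.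
  by move=> k ki; apply/eqP: (h (Ordinal ki)).
by apply/forallP => k; rewrite h.
Qed.

Lemma stratum_le l b : stratum l b -> (b <= a)%MM.
Proof. by case/andP. Qed.

Lemma stratum_full l b k : stratum l b -> (k < i)%N -> full b k = (k < l)%N.
Proof. by case/stratumP => _; apply. Qed.

(** Dividing a monomial can only empty blocks, so a divisor whose first l blocks
    are full has at most the status of block l left to decide. *)
Lemma stratum_pred l b b' : stratum l.+1 b -> (b' <= b)%MM ->
  (forall k, (k < l)%N -> (k < i)%N -> full b' k) -> stratum l.+1 b' || stratum l b'.
Proof.
move=> sb le_b fl; have b'a := lepm_trans le_b (stratum_le sb).
have above k : (k < i)%N -> (l < k)%N -> full b' k = false.
  move=> ki lk; apply: contraTF lk => /(full_mono le_b).
  by rewrite (stratum_full sb ki) ltnS -leqNgt.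
have [fl'|/negPf nfl] := boolP (full b' l); apply/orP; [left|right]; apply/stratumP;
  split=> // k ki; rewrite ?ltnS; (have [kl|lk|->] := ssrnat.ltngtP k l);
  by [exact: fl | exact: above |].
Qed.

Hypothesis blk_lt : forall v, (blk v < i)%N = (0 < a v)%N.

(** The last module of the target complex lives in degree a only: every vertex
    of the support of a is in a block, and b <= a outside of the support. *)
Lemma stratum_top b : stratum i b -> b = a.
Proof.
move=> sb; apply/mnmP => v; apply/eqP; rewrite eqn_leq.
rewrite (mnm_lepP (stratum_le sb)) /=.
have [av|] := boolP (0 < a v)%N; last by rewrite lt0n negbK => /eqP ->.
have bi : (blk v < i)%N by rewrite blk_lt.
by have := stratum_full sb bi; rewrite bi => /fullP; apply.
Qed.

Lemma stratum_self : stratum i a.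
Proof. by apply/stratumP; split=> [|k ki]; rewrite ?lepm_refl // ki; apply/fullP. Qed.

End Strata.

(** * A map from a resolution to the complex of strata *)
Section Functional.
Variables (K : fieldType) (n : nat).
Local Notation R := {mpoly K[n]}.
Variables (J : R -> Prop) (M : pred 'X_{1..n}).
Hypothesis J_mon : forall p, J p <-> {in msupp p, forall m, M m}.
Variable F : graded_free_resolution J.
Variables (i : nat) (a : 'X_{1..n}) (blk : 'I_n -> nat).
Hypothesis blk_lt : forall v, (blk v < i)%N = (0 < a v)%N.
Hypothesis M_full : forall b, M b -> (b <= a)%MM ->
  exists2 k, (k < i)%N & full a blk b k.

Local Notation stratum := (stratum i a blk).
Local Notation full := (full a blk).

Lemma stratum0_notM b : stratum 0 b -> ~~ M b.
Proof.
move=> sb; apply/negP => /M_full[|k ki]; first exact: stratum_le sb.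
by rewrite (stratum_full sb ki).
Qed.

(** The chain map F_l -> C_l on basis vectors, written in absolute multidegrees.
    Since C_l -> C_(l-1) is the identity wherever both are nonzero, lifting
    through it amounts to keeping the coefficients in stratum l. In the degrees
    with l+1 full blocks C_l maps to 0, so the lift is free there, and 0 is
    chosen. *)
Fixpoint stratum_map l : 'cV[R]_(gfr_rank F l) :=
  match l with
  | 0 => \col_k mtrunc (stratum 0) (gfr_aug F k 0)
  | l'.+1 => \col_k mtrunc (stratum l'.+1) ((gfr_diff F l' *m stratum_map l') k 0)
  end.

Lemma stratum_map_supp l k m : m \in msupp (stratum_map l k 0) -> stratum l m.
Proof. by case: l k => [|l] k; rewrite mxE mem_trunc => /andP[]. Qed.

(** The coefficients of [stratum_map l] have their first l blocks full, and
    multiplication by a polynomial only fills more blocks. *)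
Lemma mul_stratum_map_full l (w : 'rV[R]_(gfr_rank F l)) b k :
  (b <= a)%MM -> ((w *m stratum_map l) 0 0)@_b != 0 -> (k < l)%N -> (k < i)%N -> full b k.
Proof.
move=> ba nz kl ki.
have [j] : exists j, (w 0 j * stratum_map l j 0)@_b != 0.
  apply/existsP; apply: contraR nz; rewrite negb_exists => /forallP h.
  rewrite mcoeff_mulmx big1 // => j _; apply/eqP; have:= h j; by rewrite negbK.
case/mcoeffM_supp => m1 [m2 [_ /stratum_map_supp sm ->]].
by apply: (full_mono (lem_addl _ _)); rewrite (stratum_full sm).
Qed.

Lemma mul_stratum_map0 (w : 'rV[R]_(gfr_rank F 0)) b : stratum 0 b ->
  ((w *m stratum_map 0) 0 0)@_b = ((w *m gfr_aug F) 0 0)@_b.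
Proof.
move=> sb; apply: eq_mcoeff_mulmx => k b' le_b; rewrite mxE mcoeff_trunc.
case: ifP => // /stratumP[]; split; first exact: lepm_trans le_b (stratum_le sb).
move=> k' ki; apply: contraFF (stratum_full sb ki); exact: full_mono.
Qed.

Lemma row_mulmx_entry (A : comNzRingType) m1 m2 (B : 'M[A]_(m1, m2)) (u : 'cV[A]_m2) x :
  (B *m u) x 0 = (row x B *m u) 0 0.
Proof. by rewrite -row_mul [RHS]mxE. Qed.

Lemma aug_diff0 (w : 'rV[R]_(gfr_rank F 1)) b : stratum 0 b ->
  ((w *m gfr_diff F 0 *m gfr_aug F) 0 0)@_b = 0.
Proof.
move=> /stratum0_notM nM; apply: memN_msupp_eq0; apply: contra nM.
by apply: (proj1 (J_mon _)); apply/gfr_exact0; exists w.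
Qed.

(** The coefficients lost by the truncation do not contribute in stratum l+1:
    they sit in a divisor whose first l blocks are full, hence in stratum l by
    [stratum_pred], where the hypothesis makes them vanish. *)
Lemma stratum_map_step l :
  (forall (w : 'rV[R]_(gfr_rank F l.+1)) b, stratum l b ->
    ((w *m (gfr_diff F l *m stratum_map l)) 0 0)@_b = 0) ->
  forall (w : 'rV[R]_(gfr_rank F l.+1)) b, stratum l.+1 b ->
  ((w *m stratum_map l.+1) 0 0)@_b = ((w *m (gfr_diff F l *m stratum_map l)) 0 0)@_b.
Proof.
move=> kill w b sb; apply: eq_mcoeff_mulmx => k b' le_b.
rewrite mxE mcoeff_trunc; case: ifP => // nsb'; apply/esym/eqP.
apply: contraFT nsb' => nz.
have ba := lepm_trans le_b (stratum_le sb).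
have fl k' : (k' < l)%N -> (k' < i)%N -> full b' k'.
  by move=> *; move: nz; rewrite row_mulmx_entry => /mul_stratum_map_full; apply.
case/orP: (stratum_pred sb le_b fl) => // /(kill (delta_mx 0 k)).
by rewrite -rowE mxE => e; rewrite e eqxx in nz.
Qed.

Lemma diff_diff l : gfr_diff F l.+1 *m gfr_diff F l = 0.
Proof.
apply/row_matrixP => k; rewrite row_mul row0; apply/gfr_exactS.
by exists (delta_mx 0 k); rewrite -rowE.
Qed.

(** For l = 0 because the differential ends in J, whose monomials below a have
    a full block. For l > 0 because, up to truncation, two consecutive
    differentials are applied. *)
Lemma diff_stratum_map0 l (w : 'rV[R]_(gfr_rank F l.+1)) b : stratum l b ->
  ((w *m (gfr_diff F l *m stratum_map l)) 0 0)@_b = 0.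
Proof.
elim: l w b => [|l IH] w b sb; rewrite mulmxA.
  by rewrite mul_stratum_map0 // aug_diff0.
by rewrite stratum_map_step // !mulmxA -(mulmxA w) diff_diff mulmx0 mul0mx mxE mcoeff0.
Qed.

Lemma mul_stratum_mapS l (w : 'rV[R]_(gfr_rank F l.+1)) b : stratum l.+1 b ->
  ((w *m stratum_map l.+1) 0 0)@_b = ((w *m gfr_diff F l *m stratum_map l) 0 0)@_b.
Proof. by move=> sb; rewrite stratum_map_step ?mulmxA //; apply: diff_stratum_map0. Qed.

(** In degree a only constant terms of the matrix matter, since [stratum_map i]
    is concentrated in degree a: the map F_i -> C_i factors through
    F_i (x) K. *)
Lemma mul_stratum_map_top r (B : 'M[R]_(r, _)) x :
  ((B *m stratum_map i) x 0)@_a =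
    (map_mx (mcoeff 0%MM) B *m map_mx (mcoeff a) (stratum_map i)) x 0.
Proof.
rewrite mxE raddf_sum /= mxE; apply: eq_bigr => k _; rewrite !mxE.
have -> : stratum_map i k 0 = (stratum_map i k 0)@_a *: 'X_[a].
  apply/mpolyP => m; rewrite mcoeffZ mcoeffX.
  have [am|ne] := eqVneq a m; first by rewrite -am mulr1.
  rewrite mulr0; apply: memN_msupp_eq0; apply: contraNN ne => /stratum_map_supp sm.
  by rewrite (stratum_top blk_lt sm).
by rewrite -scalerAr !mcoeffZ mcoeffX eqxx mulr1 -{2}[a]addm0 mcoeffMX mulrC.
Qed.

Lemma tensor_diff_stratum_map : tensor_diff F i *m map_mx (mcoeff a) (stratum_map i) = 0.
Proof.
apply/colP => x; rewrite -mul_stratum_map_top [RHS]mxE.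
by rewrite row_mulmx_entry rowE -mulmxA diff_stratum_map0 //; apply: stratum_self.
Qed.

End Functional.

(** * Koszul signs *)
Section KoszulSigns.
Variable i : nat.
Implicit Types (T : {set 'I_i}) (k l : 'I_i).

Definition kpos k T : nat := #|[set l in T | (l < k)%N]|.

Lemma kposD1 k l T : l \in T -> kpos k T = (kpos k (T :\ l) + (l < k)%N)%N.
Proof.
move=> lT; rewrite /kpos; set X := [set _ in T | _].
have -> : [set u in T :\ l | (u < k)%N] = X :\ l.
  by apply/setP => u; rewrite !inE; case: (u == l).
by rewrite (cardsD1 l X) inE lT addnC.
Qed.

(** The vanishing diagonal is a separate hypothesis on account of
    characteristic 2. *)
Lemma antisym_sum (V : zmodType) (h : 'I_i -> 'I_i -> V) :
  (forall k, h k k = 0) -> (forall k l, h k l = - h l k) ->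
  \sum_k \sum_l h k l = 0.
Proof.
move=> h0 hN.
have -> : \sum_k \sum_l h k l =
    \sum_(k : 'I_i) \sum_(l : 'I_i | (k < l)%N) h k l +
    \sum_(k : 'I_i) \sum_(l : 'I_i | (l < k)%N) h k l.
  rewrite -big_split; apply: eq_bigr => k _ /=.
  rewrite (bigID (fun l : 'I_i => (k < l)%N)) /=; congr (_ + _).
  rewrite (bigD1 k) ?ltnn //= h0 add0r; apply: eq_bigl => l.
  by rewrite -leqNgt ltn_neqAle andbC.
rewrite [X in _ + X](exchange_big_dep predT) //= -big_split big1 //= => k _.
rewrite -big_split big1 //= => l _; by rewrite [h l k]hN subrr.
Qed.

(** Removing k then l, or l then k, from T gives opposite signs: exactly one of
    the two positions is shifted by the other removal. *)
Lemma koszul_square (A : pzRingType) (V : lmodType A) T (g : 'I_i -> 'I_i -> V) :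
  (forall k l, g k l = g l k) ->
  \sum_(k in T) (-1) ^+ kpos k T *:
     \sum_(l in T :\ k) (-1) ^+ kpos l (T :\ k) *: g k l = 0.
Proof.
move=> gC; rewrite big_mkcond /=.
pose h k l := if [&& k \in T, l \in T & l != k] then
  (-1) ^+ (kpos k T + kpos l (T :\ k)) *: g k l else 0.
rewrite -[RHS](@antisym_sum _ h); first last.
- move=> k l; rewrite /h andbCA (eq_sym k l); case: ifP; rewrite ?oppr0 //.
  case/and3P=> lT kT lk; rewrite -scaleNr gC; congr (_ *: _).
  rewrite (kposD1 _ lT) (kposD1 l kT) -[RHS]mulN1r -exprS -signr_odd -[RHS]signr_odd.
  congr (_ ^+ nat_of_bool _); rewrite /= !oddD !oddb -!addbA.
  have -> : (k < l)%N = ~~ (l < k)%N by rewrite -leqNgt ltn_neqAle eq_sym lk.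
  by case: (l < k)%N; do 2!case: (odd _).
- by move=> k; rewrite /h eqxx !andbF.
apply: eq_bigr => k _; rewrite /h; case: ifP => kT; last by rewrite big1.
rewrite scaler_sumr -big_mkcond /=; apply: eq_big => l; first by rewrite !inE andbC.
by move=> _; rewrite scalerA exprD.
Qed.

End KoszulSigns.

(** * Homogeneous lifts of a Koszul complex *)
Section HomogeneousParts.
Variables (K : fieldType) (n : nat).
Local Notation R := {mpoly K[n]}.

Lemma mcoeff_signM e (q : R) m : ((-1) ^+ e * q)@_m = (-1) ^+ e * q@_m.
Proof.
rewrite -signr_odd mulr_sign -[in RHS]signr_odd mulr_sign.
by case: odd; rewrite ?mcoeffN.
Qed.

Lemma msupp_signM e (q : R) : msupp ((-1) ^+ e * q) =i msupp q.
Proof. by move=> m; rewrite !mcoeff_msupp mcoeff_signM mulf_eq0 signr_eq0. Qed.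

Definition hpart (e g : nat) : R -> R := mtrunc (fun m => mdeg m + g == e)%N.

(** Multiplication by a q that is homogeneous between shifts g and h commutes
    with taking the part of total degree e. It is stated on coefficients, so
    that a shift above e needs no truncated subtraction. *)
Lemma mcoeff_hpartM e g h (p q : R) m :
  (forall m', m' \in msupp q -> mdeg m' + h = g)%N ->
  (hpart e g p * q)@_m = if (mdeg m + h == e)%N then (p * q)@_m else 0.
Proof.
move=> hq; rewrite !mcoeffM.
transitivity (\sum_(k : 'X_{1..n < (mdeg m).+1, (mdeg m).+1} | m == (k.1 + k.2)%MM)
   if (mdeg m + h == e)%N then p@_k.1 * q@_k.2 else 0); last first.
  by case: ifP => // _; rewrite big1.
apply: eq_bigr => k /eqP m_k; rewrite mcoeff_trunc.
have [/hq dk2|/memN_msupp_eq0 ->] := boolP ((k.2 : 'X_{1..n}) \in msupp q); last first.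
  by rewrite !mulr0 if_same.
have -> : (mdeg m + h = mdeg k.1 + g)%N.
  by rewrite -dk2 addnA -mdegD -m_k.
by case: ifP; rewrite ?mul0r.
Qed.

End HomogeneousParts.

Section KoszulLift.
Variables (K : fieldType) (n : nat).
Local Notation R := {mpoly K[n]}.
Variables (J : R -> Prop) (M : pred 'X_{1..n}).
Hypothesis J_mon : forall p, J p <-> {in msupp p, forall m, M m}.
Hypothesis M_up : forall m m', M m -> (m <= m')%MM -> M m'.
Variable F : graded_free_resolution J.

Definition row_homog l e (v : 'rV[R]_(gfr_rank F l)) :=
  forall k m, m \in msupp (v 0 k) -> (mdeg m + gfr_deg k = e)%N.

Definition row_hpart l e (v : 'rV[R]_(gfr_rank F l)) : 'rV[R]_(gfr_rank F l) :=
  \row_k hpart e (gfr_deg k) (v 0 k).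

Lemma row_hpart_homog l e (v : 'rV[R]_(gfr_rank F l)) : row_homog e (row_hpart e v).
Proof. by move=> k m; rewrite mxE mem_trunc => /andP[/eqP]. Qed.

Lemma row_hpart_diff l e (v : 'rV[R]_(gfr_rank F l)) w :
  row_homog e v -> v = w *m gfr_diff F l -> v = row_hpart e w *m gfr_diff F l.
Proof.
move=> hv v_w; apply/rowP => c; apply/mpolyP => m.
have -> : ((row_hpart e w *m gfr_diff F l) 0 c)@_m =
    if (mdeg m + gfr_deg c == e)%N then (v 0 c)@_m else 0.
  rewrite v_w !mxE !raddf_sum /=.
  transitivity (\sum_k if (mdeg m + gfr_deg c == e)%N
     then (w 0 k * gfr_diff F l k c)@_m else 0); last by case: ifP => // _; rewrite big1.
  apply: eq_bigr => k _; rewrite mxE; apply: mcoeff_hpartM.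
  by move=> m'; apply: gfr_diff_homog.
case: ifP => // /eqP ne; apply: memN_msupp_eq0; by apply/negP => /hv.
Qed.

(** By exactness this decides whether v lifts along the next differential, so
    that lifts can be chosen constructively. Decidability at the bottom comes
    from J being a monomial ideal. *)
Definition is_cycle l : 'rV[R]_(gfr_rank F l) -> bool :=
  match l with
  | 0 => fun v => all M (msupp ((v *m gfr_aug F) 0 0))
  | l'.+1 => fun v => v *m gfr_diff F l' == 0
  end.

Lemma cycle_lift l v : is_cycle v -> exists w, v = w *m gfr_diff F l.
Proof.
case: l v => [|l] v /=.
  by move/allP => vM; apply/gfr_exact0/J_mon.
by move/eqP/gfr_exactS.
Qed.

(** Since the differential is homogeneous, the degree e part of any lift of a
    vector of degree e is again a lift. *)
Lemma homog_lift_sig l e (v : 'rV[R]_(gfr_rank F l)) :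
  {w | row_homog e w /\ (row_homog e v -> is_cycle v -> w *m gfr_diff F l = v)}.
Proof.
have [cv|ncv] := boolP (is_cycle v); last first.
  by exists (row_hpart e 0); split=> //; apply: row_hpart_homog.
have ex : exists w, v == w *m gfr_diff F l.
  by have [w ->] := cycle_lift cv; exists w.
exists (row_hpart e (xchoose ex)); split; first exact: row_hpart_homog.
by move=> hv _; apply/esym/row_hpart_diff => //; apply/eqP/(xchooseP ex).
Qed.

Definition homog_lift l e v := sval (@homog_lift_sig l e v).

Variables (i : nat) (p : 'I_i -> 'I_n) (c : 'X_{1..n}).
Hypothesis M_p : forall k, M (c + U_(p k))%MM.

Lemma koszul_start :
  exists2 v, row_homog (mdeg c) v & J ('X_[c] - (v *m gfr_aug F) 0 0).
Proof.
have [v Jv] := gfr_aug_surj F 'X_[c].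
exists (row_hpart (mdeg c) v); first exact: row_hpart_homog.
apply/J_mon => m; rewrite mcoeff_msupp mcoeffB.
have -> : ((row_hpart (mdeg c) v *m gfr_aug F) 0 0)@_m =
    if (mdeg m + 0 == mdeg c)%N then ((v *m gfr_aug F) 0 0)@_m else 0.
  rewrite !mxE !raddf_sum /=.
  transitivity (\sum_k if (mdeg m + 0 == mdeg c)%N
     then (v 0 k * gfr_aug F k 0)@_m else 0); last by case: ifP => // _; rewrite big1.
  apply: eq_bigr => k _; rewrite mxE; apply: mcoeff_hpartM.
  by move=> m'; rewrite addn0; apply: gfr_aug_homog.
rewrite addn0; have [_|ne] := eqVneq (mdeg m) (mdeg c).
  by rewrite -mcoeffB -mcoeff_msupp; apply: (proj1 (J_mon _)).
by rewrite subr0 mcoeffX; case: (c =P m) ne => [->|]; rewrite eqxx.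
Qed.

Variable v0 : 'rV[R]_(gfr_rank F 0).
Hypothesis v0_homog : row_homog (mdeg c) v0.
Hypothesis v0_aug : J ('X_[c] - (v0 *m gfr_aug F) 0 0).

Definition koszul_boundary l (f : {set 'I_i} -> 'rV[R]_(gfr_rank F l)) (T : {set 'I_i}) :=
  \sum_(k in T) (-1) ^+ kpos k T *: ('X_(p k) *: f (T :\ k)).

(** The lift of the Koszul complex on the variables x_(p k): the basis element
    indexed by T goes to [koszul_map #|T| T]. *)
Fixpoint koszul_map l : {set 'I_i} -> 'rV[R]_(gfr_rank F l) :=
  match l with
  | 0 => fun _ => v0
  | l'.+1 => fun T => homog_lift (mdeg c + l'.+1) (koszul_boundary (@koszul_map l') T)
  end.

Lemma row_homog_sum l e (I : finType) (P : pred I) (f : I -> 'rV[R]_(gfr_rank F l)) :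
  (forall k, P k -> row_homog e (f k)) -> row_homog e (\sum_(k | P k) f k).
Proof.
move=> hf k m; rewrite summxE mcoeff_msupp raddf_sum /= => nz.
have [j /andP[Pj nzj]] : exists j, P j && ((f j 0 k)@_m != 0).
  apply/existsP; apply: contraR nz; rewrite negb_exists => /forallP h.
  rewrite big1 // => j Pj; apply/eqP; by have:= h j; rewrite Pj negbK.
by apply: hf Pj _ _ _; rewrite mcoeff_msupp.
Qed.

Lemma koszul_map_homog l T : row_homog (mdeg c + l) (koszul_map l T).
Proof.
case: l => [|l] /=; first by rewrite addn0.
by case: (svalP (homog_lift_sig (mdeg c + l.+1) (koszul_boundary (koszul_map l) T))).
Qed.

Lemma koszul_boundary_homog l T : row_homog (mdeg c + l.+1) (koszul_boundary (koszul_map l) T).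
Proof.
apply: row_homog_sum => k _ j m; rewrite !mxE msupp_signM.
rewrite mcoeff_msupp mcoeffXM; case: ifP => [mp|]; last by rewrite eqxx.
rewrite -mcoeff_msupp => /koszul_map_homog e; rewrite addnS -e -addSn; congr (_ + _)%N.
have Um : (U_(p k) <= m)%MM by rewrite lep1mP -lt0n.
by rewrite -{1}(submK Um) mdegD mdeg1 addn1.
Qed.

(** By induction each Koszul boundary is a cycle: at the bottom since each x_(p k)
    multiplies x^c into J, above by [koszul_square]. *)
Lemma koszul_map_diff l (T : {set 'I_i}) : #|T| = l.+1 ->
  koszul_map l.+1 T *m gfr_diff F l = koszul_boundary (koszul_map l) T.
Proof.
have lift_bd l' T' : is_cycle (koszul_boundary (koszul_map l') T') ->
    koszul_map l'.+1 T' *m gfr_diff F l' = koszul_boundary (koszul_map l') T'.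
  have [_ h] := svalP (homog_lift_sig (mdeg c + l'.+1) (koszul_boundary (koszul_map l') T')).
  by move=> cyc; apply: h => //; apply: koszul_boundary_homog.
elim: l T => [|l IH] T cT; apply: lift_bd.
- move/eqP/cards1P: cT => [k ->]; apply/allP => m.
  rewrite /koszul_boundary big_set1 /= -!scalemxAl !mxE msupp_signM.
  set q := \sum_j _; have qE : q = (v0 *m gfr_aug F) 0 0 by rewrite mxE.
  rewrite mcoeff_msupp mcoeffXM; case: ifP => [mp|]; last by rewrite eqxx.
  have Um : (U_(p k) <= m)%MM by rewrite lep1mP -lt0n.
  have [cE|ne] := eqVneq c (m - U_(p k))%MM => [_|nz].
    by have := M_p k; rewrite cE submK.
  apply: M_up (lem_subr m U_(p k)).
  apply: (proj1 (J_mon _) v0_aug); rewrite mcoeff_msupp mcoeffB mcoeffX (negPf ne).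
  by rewrite -qE sub0r oppr_eq0.
rewrite /=; apply/eqP; rewrite {1}/koszul_boundary mulmx_suml.
transitivity (\sum_(k in T) (-1) ^+ kpos k T *:
  \sum_(u in T :\ k) (-1) ^+ kpos u (T :\ k) *:
    (('X_(p k) * 'X_(p u)) *: koszul_map l (T :\ k :\ u)) : 'rV[R]_(gfr_rank F l)).
  apply: eq_bigr => k kT; rewrite -!scalemxAl; congr (_ *: _).
  rewrite IH; last by apply/eqP; rewrite -eqSS -cT [in X in _ == X](cardsD1 k) kT.
  rewrite scaler_sumr; apply: eq_bigr => u _.
  by rewrite !scalerA mulrCA mulrA.
apply: (koszul_square _ (g := fun k u => ('X_(p k) * 'X_(p u)) *: koszul_map l (T :\ k :\ u))).
by move=> k u; rewrite mulrC setDDl setUC -setDDl.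
Qed.

End KoszulLift.

(** * Pairing Koszul lifts with strata *)
Section Pairing.
Variables (K : fieldType) (n : nat).
Local Notation R := {mpoly K[n]}.
Variables (J : R -> Prop) (M : pred 'X_{1..n}).
Hypothesis J_mon : forall p, J p <-> {in msupp p, forall m, M m}.
Variable F : graded_free_resolution J.
Variables (i : nat) (a : 'X_{1..n}) (blk : 'I_n -> nat).
Hypothesis blk_lt : forall v, (blk v < i)%N = (0 < a v)%N.
Hypothesis M_full : forall b, M b -> (b <= a)%MM ->
  exists2 k, (k < i)%N & full a blk b k.
Variables (p : 'I_i -> 'I_n) (c : 'X_{1..n}).
Hypothesis p_inj : injective p.
Variable f : forall l, {set 'I_i} -> 'rV[R]_(gfr_rank F l).
Hypothesis f_aug : J ('X_[c] - (f 0 set0 *m gfr_aug F) 0 0).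
Hypothesis f_diff : forall l (T : {set 'I_i}), #|T| = l.+1 ->
  f l.+1 T *m gfr_diff F l = koszul_boundary p (f l) T.

Local Notation stratum := (stratum i a blk).
Local Notation full := (full a blk).
Local Notation stratum_map := (stratum_map F i a blk).
Implicit Types (T : {set 'I_i}) (k : 'I_i).

(** The basis element T of the Koszul complex is compared with the target in
    degree a - p + (sum of the p_k, k in T), that is [rdeg T] when [rest T]
    is at most a. *)
Definition rest T : 'X_{1..n} := mnm_ind (p @: ~: T).
Definition rdeg T : 'X_{1..n} := (a - rest T)%MM.

Definition pairing l T : K :=
  if (rest T <= a)%MM then ((f l T *m stratum_map l) 0 0)@_(rdeg T) else 0.

Definition on_stratum l T := (rest T <= a)%MM && stratum l (rdeg T).

Lemma restE T k : rest T (p k) = (k \notin T) :> nat.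
Proof. by rewrite mnm_indE mem_imset // inE. Qed.

Lemma restD1 T k : k \in T -> rest (T :\ k) = (rest T + U_(p k))%MM.
Proof.
move=> kT; apply/mnmP => v; rewrite mnmDE mnm1E !mnm_indE setCD setUC.
rewrite imsetU imset_set1 inE in_set1 eq_sym; case: eqP => [<-|_]; last by rewrite addn0.
by rewrite mem_imset // inE kT.
Qed.

Lemma le_rest T k : (rest T <= rest (T :\ k))%MM.
Proof.
apply/mnm_lepP => v; rewrite !mnm_indE.
have: (p @: (~: T)) \subset (p @: (~: (T :\ k))) by rewrite imsetS // setCS subD1set.
by move/subsetP/(_ v); case: (v \in _) => // ->.
Qed.

Lemma rdeg_le T : (rdeg T <= a)%MM.
Proof. exact: lem_subr. Qed.

Lemma rdegD1_le T k : (rdeg (T :\ k) <= rdeg T)%MM.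
Proof.
apply/mnm_lepP => v; rewrite !mnmBE leq_sub2l //; exact: (mnm_lepP (le_rest T k)).
Qed.

(** The two chain maps are compatible with the differentials, and in stratum
    l+1 the differential of the target is the identity. *)
Lemma pairing_step l T : #|T| = l.+1 -> on_stratum l.+1 T ->
  pairing l.+1 T = \sum_(k in T) (-1) ^+ kpos k T * pairing l (T :\ k).
Proof.
move=> cT /andP[gT sT]; rewrite /pairing gT (mul_stratum_mapS J_mon M_full _ sT) f_diff //.
rewrite /koszul_boundary mulmx_suml summxE raddf_sum /=; apply: eq_bigr => k kT.
rewrite -!scalemxAl mxE mcoeff_signM mxE mcoeffXM; congr (_ * _).
rewrite /rdeg restD1 // mnmBE restE kT subn0 -submDA.
have -> // : (rest T + U_(p k) <= a)%MM = (0 < a (p k))%N.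
apply/mnm_lepP/idP => [/(_ (p k))|ak v]; rewrite mnmDE mnm1E.
  by rewrite restE kT eqxx.
case: eqP => [<-|_]; first by rewrite restE kT.
by rewrite addn0; apply: (mnm_lepP gT).
Qed.

Lemma pairing_full l T : pairing l T != 0 ->
  (rest T <= a)%MM /\ (forall j, (j < l)%N -> (j < i)%N -> full (rdeg T) j).
Proof.
rewrite /pairing; case: ifP => [gT nz|]; last by rewrite eqxx.
by split=> // k' kl ki; apply: (mul_stratum_map_full (rdeg_le T) nz).
Qed.

Lemma pairing0 : on_stratum 0 set0 -> pairing 0 set0 = (c == rdeg set0)%:R.
Proof.
case/andP=> g0 s0; rewrite /pairing g0 mul_stratum_map0 // -mcoeffX.
apply/esym/eqP; rewrite -subr_eq0 -mcoeffB mcoeff_eq0.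
by apply: contra (stratum0_notM M_full s0); apply: (proj1 (J_mon _)).
Qed.

(** A null-homotopy of the composite in the degrees [rdeg T]. Its value at T lies
    in the module one step up, hence the condition on stratum #|T|+1 = l. It is
    forced there, because the target differential is the identity. The index is
    shifted by one so that the homotopy starts with 0. *)
Fixpoint homotopy l T : K :=
  if l is l'.+1 then
    if on_stratum l T then
      pairing l' T - \sum_(k in T) (-1) ^+ kpos k T * homotopy l' (T :\ k)
    else 0
  else 0.

Lemma homotopy_out l T : ~~ on_stratum l T -> homotopy l T = 0.
Proof. by case: l => [|l] //= /negPf ->. Qed.

Lemma on_stratum_sub l T k : on_stratum l.+1 T -> (rest (T :\ k) <= a)%MM ->
  (forall j, (j < l)%N -> (j < i)%N -> full (rdeg (T :\ k)) j) ->
  on_stratum l.+1 (T :\ k) || on_stratum l (T :\ k).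
Proof.
move=> /andP[_ sT] gT fl; rewrite /on_stratum gT /=.
exact: stratum_pred sT (rdegD1_le _ _) fl.
Qed.

(** Expanding by [pairing_step], each term is the homotopy identity of the set
    [T :\ k] (clear on stratum l+1, by induction on stratum l, and 0 = 0
    elsewhere), and the iterated sums cancel by [koszul_square]. *)
Lemma pairing_homotopy l T :
  ((rest set0 <= a)%MM -> c != rdeg set0) -> #|T| = l -> on_stratum l T ->
  pairing l T = \sum_(k in T) (-1) ^+ kpos k T * homotopy l (T :\ k).
Proof.
move=> c_ne; elim: l T => [|l IH] T cT sT.
  move/eqP: cT sT; rewrite cards_eq0 => /eqP -> s0.
  by rewrite big_set0 pairing0 // (negPf (c_ne _)) //; case/andP: s0.
rewrite pairing_step //.
have bd k : k \in T -> pairing l (T :\ k) = homotopy l.+1 (T :\ k) +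
    \sum_(u in T :\ k) (-1) ^+ kpos u (T :\ k) * homotopy l (T :\ k :\ u).
  move=> kT; have cTk : #|T :\ k| = l.
    by apply/eqP; rewrite -eqSS -cT [in X in _ == X](cardsD1 k) kT.
  have [s1|ns1] := boolP (on_stratum l.+1 (T :\ k)); first by rewrite /= s1 subrK.
  rewrite homotopy_out // add0r.
  have [s0|ns0] := boolP (on_stratum l (T :\ k)); first exact: IH.
  have nfl : (rest (T :\ k) <= a)%MM ->
     (forall j, (j < l)%N -> (j < i)%N -> full (rdeg (T :\ k)) j) -> False.
    by move=> g /(on_stratum_sub sT g); rewrite (negPf ns1) (negPf ns0).
  rewrite big1 => [|u _]; last first.
    rewrite homotopy_out ?mulr0 //; apply/negP => /andP[gu su].
    apply: nfl => [|k' kl ki]; first exact: lepm_trans (le_rest _ u) gu.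
    by apply: (full_mono (rdegD1_le _ u)); rewrite (stratum_full su).
  by apply/eqP; apply/negPn/negP => /pairing_full[/nfl].
rewrite (eq_bigr (fun k => (-1) ^+ kpos k T * homotopy l.+1 (T :\ k) +
   (-1) ^+ kpos k T *
    \sum_(u in T :\ k) (-1) ^+ kpos u (T :\ k) * homotopy l (T :\ k :\ u))).
  rewrite big_split /= [X in _ + X](koszul_square (V := K^o) _
    (g := fun k u => homotopy l (T :\ k :\ u))) ?addr0 //.
  by move=> k u; rewrite setDDl setUC -setDDl.
by move=> k kT; rewrite bd // mulrDr.
Qed.

Lemma rdegT : rdeg setT = a.
Proof. by apply/mnmP => v; rewrite mnmBE mnm_indE setCT imset0 inE subn0. Qed.

Lemma restT_le : (rest setT <= a)%MM.
Proof. by apply/mnm_lepP => v; rewrite mnm_indE setCT imset0 inE. Qed.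

Lemma pairingT : pairing i setT = ((f i setT *m stratum_map i) 0 0)@_a.
Proof. by rewrite /pairing restT_le rdegT. Qed.

(** The homotopy vanishes one step below the top: if the only removed variable
    p_k divides x^a, then x^a / x_(p_k) is no longer in the last stratum. *)
Lemma pairing_neq : ((rest set0 <= a)%MM -> c != rdeg set0) -> pairing i setT = 0.
Proof.
move=> c_ne; rewrite pairing_homotopy ?cardsT ?card_ord //; last first.
  by rewrite /on_stratum restT_le rdegT stratum_self.
rewrite big1 // => k _; rewrite homotopy_out ?mulr0 //; apply/negP => /andP[g].
move/(stratum_top blk_lt)/mnmP/(_ (p k)); move/mnm_lepP/(_ (p k)): g.
rewrite mnmBE restE !inE eqxx /=; case: (a (p k)) => // x _ /eqP.
by rewrite subSS subn0 ltn_eqF.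
Qed.

Hypothesis blk_p : forall k, blk (p k) = k.

Lemma full_rdeg T k : full (rdeg T) k = (k \in T).
Proof.
have ak : (0 < a (p k))%N by rewrite -blk_lt blk_p.
apply/fullP/idP => [/(_ _ (blk_p k))|kT v vk].
  rewrite mnmBE restE; case: (k \in T) => //=; move: ak; case: (a (p k)) => // x _.
  by rewrite subSS subn0 ltnn.
rewrite mnmBE mnm_indE (_ : v \in _ = false) ?subn0 //.
apply/negP => /imsetP[k']; rewrite inE => nk' v_k'.
by move: nk'; rewrite (_ : k' = k) ?kT //; apply: val_inj; rewrite /= -blk_p -v_k'.
Qed.

Lemma rest_le T : (rest T <= a)%MM.
Proof.
apply/mnm_lepP => v; rewrite mnm_indE; case: imsetP => // [[k _ ->]].
by rewrite -blk_lt blk_p.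
Qed.

(** Along T = {0, ..., l-1} only the term of the last index survives in
    [pairing_step], as removing any other one leaves a block below l not
    full. So all these pairings agree up to sign, down to the coefficient 1 of
    the monomial m. *)
Lemma pairing_eq : c = rdeg set0 -> pairing i setT != 0.
Proof.
move=> c_eq.
suff h l : (l <= i)%N -> pairing l [set k : 'I_i | (k < l)%N] != 0.
  rewrite (_ : setT = [set k : 'I_i | (k < i)%N]) ?h //.
  by apply/setP => k; rewrite !inE ltn_ord.
have on l' : on_stratum l' [set k : 'I_i | (k < l')%N].
  rewrite /on_stratum rest_le; apply/stratumP; split=> [|k ki]; first exact: rdeg_le.
  by rewrite (full_rdeg _ (Ordinal ki)) inE.
elim: l => [|l IH] li.
  have e0 : [set k : 'I_i | (k < 0)%N] = set0 by apply/setP => k; rewrite !inE.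
  by move: (on 0); rewrite e0 => /pairing0 ->; rewrite c_eq eqxx oner_eq0.
rewrite pairing_step //; last first.
  by rewrite -sum1dep_card (big_ord_narrow li) sum1_card card_ord.
rewrite (bigD1 (Ordinal li)) ?inE //= big1 ?addr0 => [|k].
  rewrite mulf_neq0 ?signr_eq0 // (_ : _ :\ _ = [set k : 'I_i | (k < l)%N]).
    exact/IH/ltnW.
  apply/setP => k; rewrite !inE -val_eqE /= ltnS; by case: ssrnat.ltngtP.
rewrite !inE -val_eqE /= ltnS => /andP[kl kne].
apply/eqP; rewrite mulf_eq0 orbC; apply/orP; left; apply/negPn/negP.
case/pairing_full => _ /(_ k); rewrite full_rdeg !inE eqxx /= => h.
by have := h _ (ltn_ord k); rewrite ltn_neqAle kne kl => /(_ isT).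
Qed.

End Pairing.

Lemma mdeg_ind n (T : {set 'I_n}) : mdeg (mnm_ind T) = #|T|.
Proof.
rewrite mdegE -sum1_card [RHS]big_mkcond; apply: eq_bigr => v _.
by rewrite mnm_indE; case: (v \in T).
Qed.

(** The combinatorial data at a multidegree [wdeg] from which a nonzero Tor class of
    homological degree i is obtained: blocks that cover its support, and one
    vertex in each block. *)
Record witness n (M : pred 'X_{1..n}) (i : nat) := Witness {
  wdeg : 'X_{1..n};
  wblk : 'I_n -> nat;
  wprv : 'I_i -> 'I_n;
  wblk_lt : forall v, (wblk v < i)%N = (0 < wdeg v)%N;
  wblk_prv : forall k, wblk (wprv k) = k;
  w_full : forall b, M b -> (b <= wdeg)%MM ->
    exists2 k, (k < i)%N & full wdeg wblk b k;
  w_prv : forall k, M (wdeg - rest wprv [set k])%MM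
}.

Lemma wprv_inj n (M : pred 'X_{1..n}) i (w : witness M i) : injective (wprv w).
Proof.
by move=> k l e; apply: val_inj; rewrite /= -(wblk_prv w) e wblk_prv.
Qed.

(** * Lower bounds for Betti numbers *)
Section BettiBound.
Variables (K : fieldType) (n : nat).
Local Notation R := {mpoly K[n]}.
Variables (J : R -> Prop) (M : pred 'X_{1..n}).
Hypothesis J_mon : forall p, J p <-> {in msupp p, forall m, M m}.
Hypothesis M_up : forall m m', M m -> (m <= m')%MM -> M m'.
Variable F : graded_free_resolution J.

Lemma tensor_diff_diff i : tensor_diff F i.+1 *m tensor_diff F i = 0.
Proof. by rewrite /tensor_diff -map_mxM diff_diff map_mx0. Qed.

Lemma tensor_comp_sub r i j (B : 'M[K]_(r, gfr_rank F i)) :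
  (forall x k, B x k != 0 -> gfr_deg k = j) -> (B <= tensor_comp F i j)%MS.
Proof.
move=> hB; have -> : B = B *m tensor_comp F i j; last exact: submxMl.
apply/matrixP => x k; rewrite mul_mx_diag !mxE.
have [->|/hB ->] := eqVneq (B x k) 0; rewrite ?mul0r //.
by rewrite eqxx mulr1.
Qed.

Lemma tor_boundaries_sub i j : (tor_boundaries F i j <= tor_cycles F i j)%MS.
Proof.
have comp : (tor_boundaries F i j <= tensor_comp F i j)%MS.
  apply: tensor_comp_sub => x k; rewrite /tor_boundaries mul_diag_mx !mxE.
  have [<-|] := eqVneq (gfr_deg x) j; last by rewrite mul0r eqxx.
  rewrite mul1r -mcoeff_msupp => /gfr_diff_homog <-.
  by rewrite mdeg0.
case: i comp => [|i] comp //=; rewrite sub_capmx comp.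
by apply/sub_kermxP; rewrite -mulmxA tensor_diff_diff mulmx0.
Qed.

Variable i0 : nat.
Local Notation i := i0.+1.

Definition witness_form (w : witness M i) : 'cV[K]_(gfr_rank F i) :=
  map_mx (mcoeff (wdeg w)) (stratum_map F i (wdeg w) (wblk w) i).

Lemma wrest_le (w : witness M i) T : (rest (wprv w) T <= wdeg w)%MM.
Proof. exact: rest_le (wblk_lt w) _ (wblk_prv w) T. Qed.

(** The constant term of the top of the Koszul lift: a cycle, since the Koszul
    differential has its entries in the maximal ideal. *)
Lemma koszul_class (w : witness M i) :
  exists2 z : 'rV[K]_(gfr_rank F i), (z <= tor_cycles F i (mdeg (wdeg w)))%MS &
    (z *m witness_form w) 0 0 != 0 /\
    forall w' : witness M i, wdeg w' != wdeg w -> (z *m witness_form w') 0 0 = 0.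
Proof.
set p := wprv w; pose c := (wdeg w - rest p set0)%MM.
have p_inj : injective p := @wprv_inj _ _ _ w.
have restk k : rest p set0 = (rest p [set k] + U_(p k))%MM.
  by rewrite -(restD1 p_inj) ?inE // setDv.
have M_p k : M (c + U_(p k))%MM.
  rewrite /c (restk k) -submDA submK ?w_prv //.
  apply/mnm_lepP => v; have := mnm_lepP (wrest_le w set0) v.
  by rewrite -/p (restk k) mnmDE mnmBE => h; rewrite leq_subRL // (leq_trans _ h) ?leq_addr.
have [v0 hv0 Jv0] := koszul_start J_mon F c.
pose f l T := koszul_map J_mon p c v0 l T.
have f_diff l (T : {set 'I_i}) : #|T| = l.+1 ->
  f l.+1 T *m gfr_diff F l = koszul_boundary p (f l) T by exact: koszul_map_diff.
exists (map_mx (mcoeff 0%MM) (f i setT)).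
  have dc : (mdeg c + i = mdeg (wdeg w))%N.
    rewrite -[wdeg w in RHS](submK (wrest_le w set0)) mdegD; congr (_ + _)%N.
    by rewrite mdeg_ind card_imset // setC0 cardsT card_ord.
  have comp : (map_mx (mcoeff 0%MM) (f i setT) <= tensor_comp F i (mdeg (wdeg w)))%MS.
    apply: tensor_comp_sub => x k; rewrite mxE ord1 -mcoeff_msupp.
    by move/(koszul_map_homog hv0); rewrite mdeg0 dc.
  rewrite sub_capmx comp; apply/sub_kermxP.
  rewrite /tensor_diff -map_mxM f_diff ?cardsT ?card_ord //.
  apply/rowP => k; rewrite !mxE summxE raddf_sum big1 //= => u _.
  by rewrite !mxE mcoeff_signM mcoeffXM mnm0E mulr0.
have f_aug : J ('X_[c] - (f 0%N set0 *m gfr_aug F) 0 0) by [].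
split=> [|w' ne]; rewrite -(mul_stratum_map_top (wblk_lt _)) -(pairingT (F := F) _ _ p f).
  exact: (pairing_eq J_mon (wblk_lt w) (@w_full _ _ _ w) p_inj f_aug f_diff (wblk_prv w)).
rewrite (pairing_neq J_mon (wblk_lt w') (@w_full _ _ _ w') p_inj f_aug f_diff) //.
move=> le'; apply: contra_neq ne => c_eq.
by rewrite -(submK le') -[RHS](submK (wrest_le w set0)) -/p -/c c_eq.
Qed.

(** On the cycles modulo the boundaries, the classes and the functionals of
    the family have an invertible diagonal pairing matrix. *)
Lemma betti_ge (X : finType) (w : X -> witness M i) j :
  (forall x, mdeg (wdeg (w x)) = j) -> injective (fun x => wdeg (w x)) ->
  (#|X| <= betti F i j)%N.
Proof.
move=> deg_w w_inj.
have /fin_all_exists[z hz] : forall x, exists z : 'rV[K]_(gfr_rank F i),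
    [/\ (z <= tor_cycles F i j)%MS, (z *m witness_form (w x)) 0 0 != 0 &
      forall y, y != x -> (z *m witness_form (w y)) 0 0 = 0].
  move=> x; have [z zc [nz z0]] := koszul_class (w x); exists z; split=> //.
    by rewrite -(deg_w x).
  by move=> y ne; apply: z0; rewrite (inj_eq w_inj).
pose Z : 'M[K]_(#|X|, gfr_rank F i) := \matrix_x z (enum_val x).
pose G : 'M[K]_(gfr_rank F i, #|X|) := \matrix_(k, x) witness_form (w (enum_val x)) k 0.
have ZGE x y : (Z *m G) x y = (z (enum_val x) *m witness_form (w (enum_val y))) 0 0.
  by rewrite !mxE; apply: eq_bigr => k _; rewrite !mxE.
have rank_ZG : \rank (Z *m G) = #|X|.
  apply: mxrank_unit; rewrite unitmxE unitfE.
  have -> : Z *m G = diag_mx (\row_x (Z *m G) x x).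
    apply/matrixP => x y; rewrite [RHS]mxE [X in X *+ _]mxE; case: eqP => [->|/eqP ne].
      by rewrite mulr1n.
    rewrite mulr0n ZGE; have [_ _ ->] := hz (enum_val x) => //.
    by rewrite (inj_eq enum_val_inj) eq_sym.
  rewrite det_diag; apply/prodf_neq0 => x _; rewrite mxE ZGE.
  by have [] := hz (enum_val x).
have Zc : (Z <= tor_cycles F i j)%MS.
  by apply/row_subP => x; rewrite rowK; have [] := hz (enum_val x).
rewrite /betti -(mxrank_mul_ker (tor_cycles F i j) G).
have : (tor_boundaries F i j <= tor_cycles F i j :&: kermx G)%MS.
  rewrite sub_capmx tor_boundaries_sub; apply/sub_kermxP.
  rewrite /tor_boundaries -mulmxA; apply/matrixP => x y.
  have e : tensor_diff F i *m G = 0.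
    have colG v : col v G = witness_form (w (enum_val v)).
      by apply/colP => k; rewrite !mxE.
    apply/matrixP => u v; have -> : (tensor_diff F i *m G) u v =
        col v (tensor_diff F i *m G) u 0 by rewrite [RHS]mxE.
    rewrite colE -mulmxA -colE colG (tensor_diff_stratum_map J_mon F (wblk_lt _) (@w_full _ _ _ _)).
    by rewrite [LHS]mxE [RHS]mxE.
  by rewrite e mulmx0.
move/mxrankS => le_b; have := mxrankS (submxMr G Zc); rewrite rank_ZG.
set r1 := \rank (_ *m G) => le_c.
by rewrite -addnBA // (leq_trans le_c) ?leq_addr.
Qed.

End BettiBound.

(** * Powers of edge ideals are monomial ideals *)
Section IdealGen.
Variables (A : comNzRingType) (G : A -> Prop).

Lemma ideal_gen0 : ideal_gen G 0.
Proof. by exists [::]; rewrite ?big_nil. Qed.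

Lemma ideal_gen_gen g : G g -> ideal_gen G g.
Proof.
move=> Gg; exists [:: (1, g)]; last by rewrite big_seq1 mul1r.
by move=> u; rewrite inE => /eqP ->.
Qed.

Lemma ideal_genD p q : ideal_gen G p -> ideal_gen G q -> ideal_gen G (p + q).
Proof.
move=> [s Gs ->] [t Gt ->]; exists (s ++ t); last by rewrite big_cat.
by move=> u; rewrite mem_cat => /orP[/Gs|/Gt].
Qed.

Lemma ideal_genMl r p : ideal_gen G p -> ideal_gen G (r * p).
Proof.
move=> [s Gs ->]; exists [seq (r * u.1, u.2) | u <- s].
  by move=> _ /mapP[u us ->] /=; apply: Gs.
by rewrite big_map mulr_sumr; apply: eq_bigr => u _; rewrite mulrA.
Qed.

End IdealGen.

Section MonomialIdeals.
Variables (K : fieldType) (n : nat).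
Local Notation R := {mpoly K[n]}.

Lemma monomial_idealP (G : R -> Prop) (M : pred 'X_{1..n}) :
  (forall m m', M m -> (m <= m')%MM -> M m') ->
  (forall g, G g -> {in msupp g, forall m, M m}) ->
  (forall m, M m -> ideal_gen G 'X_[m]) ->
  forall p, ideal_gen G p <-> {in msupp p, forall m, M m}.
Proof.
move=> M_up GM MG p; split=> [[s Gs ->] m|pM].
  rewrite mcoeff_msupp raddf_sum /= => nz.
  have /hasP[u us] : has (fun u => (u.1 * u.2)@_m != 0) s.
    apply: contraR nz => /hasPn h; rewrite big_seq big1 // => u /h.
    by rewrite negbK => /eqP.
  case/mcoeffM_supp => m1 [m2 [_ /(GM _ (Gs _ us)) Mm2 ->]].
  exact: M_up Mm2 (lem_addl _ _).
rewrite (mpolyE p) big_seq.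
elim/big_ind: _ => [|x y|m /pM Mm]; [exact: ideal_gen0 | exact: ideal_genD |].
by rewrite -mul_mpolyC; apply/ideal_genMl/MG.
Qed.

Lemma edge_monomialE (B : {set 'I_n}) : edge_monomial K B = 'X_[mnm_ind B].
Proof.
rewrite /edge_monomial mpolyXE_id big_mkcond /=; apply: eq_bigr => v _.
by rewrite mnm_indE; case: (v \in B); rewrite ?expr1 ?expr0.
Qed.

Variable E : {set {set 'I_n}}.

Fixpoint edge_power t (m : 'X_{1..n}) : bool :=
  if t is t'.+1 then
    [exists B in E, (mnm_ind B <= m)%MM && edge_power t' (m - mnm_ind B)%MM]
  else true.

Lemma edge_powerS t m : reflect
  (exists2 B, B \in E & exists2 m', edge_power t m' & m = (mnm_ind B + m')%MM)
  (edge_power t.+1 m).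
Proof.
apply: (iffP exists_inP) => -[B BE].
  case/andP=> le_B pw; exists B => //; exists (m - mnm_ind B)%MM => //.
  by rewrite addmC submK.
case=> m' pw ->; exists B => //.
by rewrite lem_addr addmC addmK.
Qed.

Lemma edge_power_up t m m' : edge_power t m -> (m <= m')%MM -> edge_power t m'.
Proof.
elim: t m m' => // t IH _ m' /edge_powerS[B BE [m pw ->]] le_m.
apply/edge_powerS; exists B => //; exists (m' - mnm_ind B)%MM.
  apply: (IH m) => //; apply/mnm_lepP => v; have := mnm_lepP le_m v.
  by rewrite mnmDE mnmBE => h; rewrite leq_subRL // (leq_trans _ h) ?leq_addr.
rewrite addmC submK //; exact: lepm_trans (lem_addr _ _) le_m.
Qed.

Lemma edge_idealP p : edge_ideal (K := K) E p <-> {in msupp p, forall m, edge_power 1 m}.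
Proof.
apply: monomial_idealP => [m m'|_ [B BE ->] m|m].
- exact: edge_power_up.
- rewrite edge_monomialE msuppX inE => /eqP ->.
  by apply/edge_powerS; exists B => //; exists 0%MM; rewrite ?addm0.
case/edge_powerS=> B BE [m' _ ->]; rewrite mpolyXD mulrC.
by apply/ideal_genMl/ideal_gen_gen; exists B; rewrite // edge_monomialE.
Qed.

Lemma edge_ideal_expP t p :
  ideal_exp (edge_ideal (K := K) E) t p <-> {in msupp p, forall m, edge_power t m}.
Proof.
elim: t p => [|t IH] p; first by split.
apply: monomial_idealP => [m m'|_ [a [b [/edge_idealP aI /IH bI ->]]] m|m].
- exact: edge_power_up.
- rewrite mcoeff_msupp => /mcoeffM_supp[m1 [m2 [/aI/edge_powerS[B BE [m' _ ->]] /bI pw ->]]].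
  apply/edge_powerS; exists B => //; exists (m' + m2)%MM; last by rewrite addmA.
  exact: edge_power_up pw (lem_addl _ _).
case/edge_powerS=> B BE [m' pw ->]; rewrite mpolyXD.
apply: ideal_gen_gen; exists 'X_[mnm_ind B], 'X_[m']; split=> //.
  apply/edge_idealP => m1; rewrite msuppX inE => /eqP ->.
  by apply/edge_powerS; exists B => //; exists 0%MM; rewrite ?addm0.
by apply/IH => m1; rewrite msuppX inE => /eqP ->.
Qed.

Lemma edge_power_split t b A : edge_power t b ->
  (mnm_ind A *+ t <= b)%MM \/ exists B, [/\ B \in E, B != A & (mnm_ind B <= b)%MM].
Proof.
elim: t b => [|t IH] b; first by left; apply/mnm_lepP => v; rewrite mnm0E.
case/edge_powerS=> B BE [m pw ->].
have [->|ne] := eqVneq B A; last first.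
  by right; exists B; rewrite lem_addr.
case: (IH _ pw) => [le_m|[C [CE neC le_m]]].
  by left; rewrite mulmS; apply/mnm_lepP => v; rewrite !mnmDE leq_add2l (mnm_lepP le_m).
by right; exists C; split=> //; apply: lepm_trans le_m (lem_addl _ _).
Qed.

Lemma edge_power_prod t A B : A \in E -> B \in E ->
  edge_power t.+1 (mnm_ind A *+ t + mnm_ind B)%MM.
Proof.
move=> AE BE; elim: t => [|t IH]; apply/edge_powerS.
  by exists B => //; exists 0%MM; rewrite // addmC.
by exists A => //; exists (mnm_ind A *+ t + mnm_ind B)%MM; rewrite // addmA mulmS.
Qed.

End MonomialIdeals.

(** * The witness of a self semi-induced matching *)
Section Combinatorics.
Variables (n : nat) (E S : {set {set 'I_n}}).

Lemma in_cover B v : B \in S -> v \in B -> v \in cover S.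
Proof. by move=> BS vB; apply/bigcupP; exists B. Qed.

Lemma private_vertex B : self_matching E S -> B \in S ->
  exists2 v, v \in B & forall C, C \in S -> v \in C -> C = B.
Proof.
case/andP=> _ /forall_inP sm BS; have /subsetPn[v vB nv] := sm _ BS.
exists v => // C CS vC; apply/eqP; apply: contraNT nv => ne.
by apply/bigcupP; exists C; rewrite // !inE ne.
Qed.

(** This is why a semi-induced matching is determined by its cover. *)
Lemma semi_induced_mem B : semi_induced_matching E S -> B \in E ->
  B \subset cover S -> B \in S.
Proof.
case/andP=> _ /forall_inP si BE sB; apply: contraTT sB => nBS.
by apply: si; rewrite inE nBS.
Qed.

(** The exponent t is that of the theorem minus 1. *)
Definition power_deg (A : {set 'I_n}) t : 'X_{1..n} :=
  (mnm_ind A *+ t + mnm_ind (cover S))%MM.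

Lemma power_degE A t v : power_deg A t v = ((v \in A) * t + (v \in cover S))%N.
Proof. by rewrite mnmDE mulmnE !mnm_indE. Qed.

Lemma mdeg_power_deg A t : mdeg (power_deg A t) = (#|A| * t + #|cover S|)%N.
Proof. by rewrite mdegD mdegMn !mdeg_ind. Qed.

(** The edge A is listed first, and each vertex belongs to the block of the
    first edge that contains it. Thus block 0 is A, and on the other blocks
    the degree is 1. *)
Lemma power_witness A t : self_semi_induced_matching E S -> A \in S ->
  exists w : witness (edge_power E t.+1) #|S|, wdeg w = power_deg A t.
Proof.
case/andP=> sm si AS; have SE : S \subset E by case/andP: sm => /andP[].
set a := power_deg A t.
pose s := A :: enum (S :\ A).
have mem_s B : (B \in s) = (B \in S).
  by rewrite inE mem_enum !inE; case: eqP => [->|].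
have uniq_s : uniq s by rewrite /= enum_uniq mem_enum !inE eqxx.
have size_s : size s = #|S| by rewrite /= -cardE [RHS](cardsD1 A) AS.
pose blk v := find (fun B : {set 'I_n} => v \in B) s.
have has_cover v : has (fun B : {set 'I_n} => v \in B) s = (v \in cover S).
  apply/hasP/bigcupP => -[B BS vB]; exists B => //; by rewrite ?mem_s // -mem_s.
have blk_mem v k : (k < #|S|)%N -> blk v = k -> v \in nth set0 s k.
  move=> kS kE; rewrite -kE in kS *.
  by apply: (@nth_find _ set0 (fun B => v \in B)); rewrite has_find size_s.
have A_cover v : v \in A -> v \in cover S by apply: in_cover.
have blk_A v : (blk v == 0%N) = (v \in A) by rewrite /blk /=; case: (v \in A).
have mem_nth_s (k : 'I_#|S|) : nth set0 s k \in S.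
  by rewrite -mem_s mem_nth // size_s.
have /fin_all_exists[p hp] : forall k : 'I_#|S|, exists v, v \in nth set0 s k /\
    forall C, C \in S -> v \in C -> C = nth set0 s k.
  by move=> k; have [v] := private_vertex sm (mem_nth_s k); exists v.
have pP k (j : nat) : (j < #|S|)%N -> p k \in nth set0 s j -> j = k.
  move=> jS pj; apply/eqP; rewrite -(nth_uniq set0 _ _ uniq_s) ?size_s //.
  apply/eqP; apply: (hp k).2 => //; exact: (mem_nth_s (Ordinal jS)).
have blk_lt v : (blk v < #|S|)%N = (0 < a v)%N.
  rewrite -size_s -has_find has_cover power_degE.
  by case: (boolP (v \in A)) => [/A_cover ->|_] //; rewrite ?addn1 // mul0n; case: (v \in _).
have blk_p k : blk (p k) = k.
  have pb : (blk (p k) < #|S|)%N.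
    rewrite -size_s -has_find; apply/hasP; exists (nth set0 s k); last by case: (hp k).
    by rewrite mem_nth ?size_s.
  exact/(pP _ _ pb)/blk_mem.
have w_full b : edge_power E t.+1 b -> (b <= a)%MM ->
    exists2 k, (k < #|S|)%N & full a blk b k.
  move=> pw le_b; case: (edge_power_split A pw) => [le_A|[B [BE neB le_B]]].
    exists 0%N; first by rewrite card_gt0; apply/set0Pn; exists A.
    apply/fullP => v /eqP; rewrite blk_A => vA; apply: leq_trans (mnm_lepP le_A v).
    by rewrite power_degE mulmnE mnm_indE vA A_cover // mulnS addnC.
  have BS : B \in S.
    apply: semi_induced_mem si BE _; apply/subsetP => v vB.
    have := leq_trans (mnm_lepP le_B v) (mnm_lepP le_b v).
    rewrite mnm_indE vB power_degE; case: (boolP (v \in A)) => [/A_cover //|_].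
    by rewrite mul0n; case: (v \in _).
  exists (index B s); first by rewrite -size_s index_mem mem_s.
  apply/fullP => v bv; apply: leq_trans (mnm_lepP le_B v).
  have vB : v \in B.
    rewrite -(nth_index set0 (_ : B \in s)) ?mem_s //.
    by apply: blk_mem; rewrite // -size_s index_mem mem_s.
  have /negPf nvA : v \notin A.
    by rewrite -blk_A bv /=; case: (A =P B) neB => [->|//]; rewrite eqxx.
  rewrite mnm_indE vB power_degE nvA mul0n.
  by case: (v \in _).
(* At p_l, l <> k, the exponent lost is the 1 contributed by the cover, and the
   edge of index k does not contain p_l. *)
have w_prv k : edge_power E t.+1 (a - rest p [set k])%MM.
  have BS := mem_nth_s k; set B := nth set0 s k in BS *.
  apply: edge_power_up (edge_power_prod t (subsetP SE _ AS) (subsetP SE _ BS)) _.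
  apply/mnm_lepP => v; rewrite mnmBE power_degE mnmDE mulmnE !mnm_indE.
  case: imsetP => [[l]|_]; last first.
    by rewrite subn0 leq_add2l; case: (boolP (v \in B)) => // /(in_cover BS) ->.
  rewrite !inE => lk ->; rewrite (in_cover (mem_nth_s l)) ?addnK; last by case: (hp l).
  case: (boolP (p l \in B)) => [/(pP l _ (ltn_ord k))/val_inj kl|_].
    by rewrite kl eqxx in lk.
  by rewrite addn0.
by exists (Witness blk_lt blk_p w_full w_prv).
Qed.

End Combinatorics.

(** * Counting matchings *)
Section Counting.
Variables (n : nat) (E : {set {set 'I_n}}).
Implicit Types (S : {set {set 'I_n}}) (A B : {set 'I_n}).

Lemma power_deg_inj t S S' A A' :
  self_semi_induced_matching E S -> self_semi_induced_matching E S' ->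
  A \in S -> A' \in S' -> power_deg S A t = power_deg S' A' t ->
  S = S' /\ ((0 < t)%N -> A = A').
Proof.
move=> /andP[sm si] /andP[sm' si'] AS AS' /mnmP e.
have SE : S \subset E by case/andP: sm => /andP[].
have SE' : S' \subset E by case/andP: sm' => /andP[].
have supp (X : {set {set 'I_n}}) (Y : {set 'I_n}) v : Y \in X ->
    (0 < power_deg X Y t v)%N = (v \in cover X).
  move=> YX; rewrite power_degE; have [/(in_cover YX) ->|_] := boolP (v \in Y).
    by rewrite addn1.
  by rewrite mul0n; case: (v \in _).
have cov : cover S = cover S'.
  by apply/setP => v; rewrite -(supp _ _ _ AS) -(supp _ _ _ AS') e.
split=> [|t0].
  apply/setP => B; apply/idP/idP => BS.
    apply: (semi_induced_mem si' (subsetP SE _ BS)); rewrite -cov.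
    by apply/subsetP => v; apply: in_cover.
  apply: (semi_induced_mem si (subsetP SE' _ BS)); rewrite cov.
  by apply/subsetP => v; apply: in_cover.
apply/setP => v; have := e v; rewrite !power_degE cov => /addIn/eqP.
by rewrite eqn_pmul2r //; do 2!case: (_ \in _).
Qed.

Lemma betti_ge_matchings (K : fieldType) (J : {mpoly K[n]} -> Prop) t
    (F : graded_free_resolution J) (X : finType)
    (f : X -> {set {set 'I_n}}) (g : X -> {set 'I_n}) i j :
  (forall p, J p <-> {in msupp p, forall m, edge_power E t.+1 m}) ->
  (forall x, self_semi_induced_matching E (f x)) ->
  (forall x, matching_type (f x) = (i, j)) ->
  (forall x, g x \in f x) ->
  forall d, (forall x, #|g x| * t = d)%N ->
  injective (fun x => power_deg (f x) (g x) t) ->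
  (#|X| <= betti F i (d + j))%N.
Proof.
move=> J_mon ssim type gf d card_g inj.
case: i type => [|i] type.
  have -> // : #|X| = 0%N; apply: eq_card0 => x.
  have := gf x; case: (type x) => /eqP; rewrite cards_eq0 => /eqP -> _.
  by rewrite inE.
have /fin_all_exists[w hw] : forall x,
    exists w : witness (edge_power E t.+1) i.+1, wdeg w = power_deg (f x) (g x) t.
  by move=> x; have := power_witness t (ssim x) (gf x); case: (type x) => ->.
apply: (@betti_ge _ _ _ _ J_mon (@edge_power_up _ E t.+1) F _ _ w) => [x|x y].
  by rewrite hw mdeg_power_deg card_g; case: (type x) => _ ->.
by rewrite !hw; apply: inj.
Qed.

(** The vertices of a witness are distinct, with one for each edge. *)
Lemma ssim_card S A : self_semi_induced_matching E S -> A \in S ->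
  (#|S| <= #|cover S|)%N.
Proof.
move=> ssim AS; have [w hw] := power_witness 0 ssim AS.
rewrite -[#|S|]card_ord -(card_imset _ (@wprv_inj _ _ _ w)).
apply/subset_leq_card/subsetP => _ /imsetP[k _ ->].
have : (0 < wdeg w (wprv w k))%N by rewrite -wblk_lt wblk_prv.
by rewrite hw power_degE muln0 add0n; case: (_ \in _).
Qed.

Lemma im_le_ssim d : (1 <= d)%N -> uniform d E ->
  ((d - 1) * im_number E <= ssim_number' E)%N.
Proof.
move=> d1 /forall_inP unif.
rewrite /im_number.
elim/big_ind: _ => [|x y|S]; first by rewrite muln0.
  by move=> hx hy; rewrite /maxn; case: ifP.
case/andP=> /andP[fam triv] si; have /andP[_ SE] := fam.
have card_B B : B \in S -> #|B| = d.
  by move=> BS; apply/eqP/unif/(subsetP SE).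
have ssim : self_semi_induced_matching E S.
  rewrite /self_semi_induced_matching si andbT /self_matching fam.
  apply/forall_inP => B BS.
  have [v vB] : exists v, v \in B.
    by apply/set0Pn; rewrite -card_gt0 card_B.
  apply/subsetPn; exists v => //; apply/bigcupP => -[C]; rewrite !inE => /andP[ne CS vC].
  have /pred0P/(_ v) := trivIsetP triv _ _ CS BS ne.
  by rewrite /= vB vC.
apply: leq_trans (leq_bigmax_cond _ ssim).
rewrite -(eqP triv) (eq_bigr (fun=> d) card_B) sum_nat_const.
by rewrite mulnBl mul1n mulnC.
Qed.

End Counting.

Lemma ssim1 n (E : {set {set 'I_n}}) B : simple_hypergraph E -> B \in E ->
  self_semi_induced_matching E [set B].
Proof.
case/and3P=> _ n0 /forall_inP anti BE.
have fam : edge_family E [set B].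
  by rewrite /edge_family -card_gt0 cards1 sub1set.
have cov : cover [set B] = B by rewrite /cover big_set1.
rewrite /self_semi_induced_matching /self_matching /semi_induced_matching fam /=.
apply/andP; split; apply/forall_inP => C; rewrite !inE.
  move/eqP->; rewrite setDv /cover big_set0 subset0.
  by apply: contraNN n0 => /eqP <-.
case/andP=> ne CE; rewrite cov; apply: contraNN ne => sub.
have /forall_inP/(_ B BE) := anti _ CE.
by rewrite sub.
Qed.

Theorem theorem1 (K : fieldType) (n : nat) (E : {set {set 'I_n}}) :
  simple_hypergraph E ->
  let I : {mpoly K[n]} -> Prop := edge_ideal E in
  [/\ (* (1) *)
      forall (t : nat), (1 <= t)%N ->
      forall F : graded_free_resolution (ideal_exp I t),
      forall (S : {set {set 'I_n}}) (i j : nat),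
        self_semi_induced_matching E S -> matching_type S = (i, j) ->
      forall A : {set 'I_n}, A \in S ->
        betti F i (#|A| * (t - 1) + j)%N != 0%N /\
        (forall r : int, is_reg F r ->
          (#|A| * (t - 1))%N%:Z + (#|cover S|%:Z - i%:Z) <= r),
      (* (2) *)
      forall i j : nat,
        (forall F : graded_free_resolution I,
          (num_ssim E i j <= betti F i j)%N) /\
        (forall d : nat, (2 <= d)%N -> uniform d E ->
         forall t : nat, (1 < t)%N ->
         forall F : graded_free_resolution (ideal_exp I t),
          (num_ssim E i j * i <= betti F i (d * (t - 1) + j))%N)
    & (* (3) *)
      forall d : nat, (2 <= d)%N -> uniform d E ->
      forall t : nat, (1 <= t)%N ->
        (d * (t - 1) + (d - 1) * im_number E
           <= d * (t - 1) + ssim_number' E)%N /\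
        (forall F : graded_free_resolution (ideal_exp I t),
         forall r : int, is_reg F r ->
          (d * (t - 1) + ssim_number' E)%N%:Z <= r)].
Proof.
move=> simple I.
have one t : (1 <= t)%N ->
      forall F : graded_free_resolution (ideal_exp I t),
      forall (S : {set {set 'I_n}}) (i j : nat),
        self_semi_induced_matching E S -> matching_type S = (i, j) ->
      forall A : {set 'I_n}, A \in S ->
        betti F i (#|A| * (t - 1) + j)%N != 0%N /\
        (forall r : int, is_reg F r ->
          (#|A| * (t - 1))%N%:Z + (#|cover S|%:Z - i%:Z) <= r).
  case: t => // t _ F S i j ssim type A AS; rewrite subSS subn0.
  have nz : betti F i (#|A| * t + j) != 0%N.
    rewrite -lt0n -[0.+1]card_unit.
    apply: (betti_ge_matchings F (f := fun=> S) (g := fun=> A) (t := t)) => [||||_|].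
    - exact: edge_ideal_expP.
    - by [].
    - by [].
    - by [].
    - by [].
    by do 2!case.
  split=> // r [_ /(_ _ _ nz)]; case: type => _ <-.
  by rewrite addrA -PoszD.
split=> // [i j|d d2 unif t t1].
  pose Q := [set S | self_semi_induced_matching E S & matching_type S == (i, j)].
  split=> [F|d d2 unif t t1 F].
    pose X : finType := {S : {set {set 'I_n}} | S \in Q}.
    have prop (x : X) : self_semi_induced_matching E (val x) /\
        matching_type (val x) = (i, j).
      by have := valP x; rewrite inE => /andP[? /eqP].
    have /fin_all_exists[g hg] : forall x : X, exists A, A \in val x.
      by move=> x; apply/set0Pn; have [/andP[/andP[/andP[]]]] := prop x.
    rewrite /num_ssim -/Q -card_sig -[j in betti _ _ j]add0n.
    apply: (betti_ge_matchings F (f := fun x : X => val x) (g := g) (t := 0)).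
    - exact: edge_idealP.
    - by move=> x; case: (prop x).
    - by move=> x; case: (prop x).
    - exact: hg.
    - by move=> x; rewrite muln0.
    move=> x y e; apply: val_inj.
    by case: (power_deg_inj (prop x).1 (prop y).1 (hg x) (hg y) e).
  case: t t1 F => [//|t] t0 F; rewrite subSS subn0.
  pose X : finType := {x : {set {set 'I_n}} * {set 'I_n} | (x.1 \in Q) && (x.2 \in x.1)}.
  have prop (x : X) : [/\ self_semi_induced_matching E (val x).1,
      matching_type (val x).1 = (i, j) & (val x).2 \in (val x).1].
    by have /andP[] := valP x; rewrite inE => /andP[? /eqP].
  have -> : (num_ssim E i j * i = #|X|)%N.
    rewrite card_sig -sum1_card -(pair_big_dep (mem Q) (fun S A => A \in S) (fun _ _ => 1%N)) /=.
    rewrite (eq_bigr (fun=> i)) ?sum_nat_const // => S.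
    by rewrite inE sum1_card => /andP[_ /eqP[->]].
  apply: (betti_ge_matchings F (f := fun x : X => (val x).1) (g := fun x => (val x).2) (t := t)).
  - exact: edge_ideal_expP.
  - by move=> x; case: (prop x).
  - by move=> x; case: (prop x).
  - by move=> x; case: (prop x).
  - move=> x; congr (_ * _)%N; apply/eqP/(forall_inP unif).
    by have [/andP[/andP[/andP[_ /subsetP SE] _] _] _ /SE] := prop x.
  move=> x y e; apply: val_inj.
  have [sx _ ax] := prop x; have [sy _ ay] := prop y.
  have [e1 e2] := power_deg_inj sx sy ax ay e.
  by rewrite [val x]surjective_pairing [val y]surjective_pairing e1 e2.
split; first by rewrite leq_add2l im_le_ssim // ltnW.
move=> F r reg.
have [B BE] : exists B, B \in E by apply/set0Pn; case/and3P: simple.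
have [S ssim ->] : exists2 S, self_semi_induced_matching E S &
    ssim_number' E = (#|cover S| - #|S|)%N.
  have [|S ssim eS] := @eq_bigmax_cond _ (self_semi_induced_matching E)
    (fun S => #|cover S| - #|S|)%N; last by exists S.
  by apply/card_gt0P; exists [set B]; apply: ssim1.
have /set0Pn[A AS] : S != set0 by case/andP: (ssim) => /andP[/andP[]].
have [_ /(_ _ reg)] := one t t1 F S _ _ ssim erefl A AS.
have -> : #|A| = d.
  apply/eqP/(forall_inP unif).
  by case/andP: (ssim) => /andP[/andP[_ /subsetP SE] _] _; apply: SE.
by rewrite PoszD subzn // (ssim_card ssim AS).
Qed.
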